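(* Let $A$ be a monoid. (i) The valuation spectrum $Spv(A)$ is a spectral space with a basis of quasi-compact open subsets given by the subbasis consisting of the sets $Spv(A)\left(\frac{a}{b}\right)$ for $a,b\in A$ (that is, the finite intersections of these sets are quasi-compact and form a basis). The Boolean algebra generated by the sets $Spv(A)\left(\frac{a}{b}\right)$, $a,b\in A$, gives a basis for the patch topology on $Spv(A)$. (ii) Any monoid morphism $f:A\to B$ induces a spectral map $Spv(f):Spv(B)\to Spv(A)$, $v\mapsto v\circ f$. This gives a contravariant functor from the category of monoids to the category of spectral spaces and spectral maps.
   Context: A monoid means a commutative monoid, written multiplicatively, with identity $1$ and a base point $0$ satisfying $0\cdot a=0$; morphisms preserve products, $1$ and $0$. For a totally ordered abelian group $\Gamma$ (multiplicative), $\Gamma_*=\Gamma\cup\{0\}$ is the totally ordered monoid with $\gamma\cdot0=0$ and $0\le\gamma$ for all $\gamma$. A valuation of $A$ with values in $\Gamma_*$ is a map $v:A\to\Gamma_*$ with $v(xy)=v(x)v(y)$, $v(0)=0$, $v(1)=1$. Two valuations $v,w$ of $A$ are equivalent if for all $x,y\in A$: $v(x)\le v(y)\iff w(x)\le w(y)$. The valuation spectrum $Spv(A)$ is the set of equivalence classes of valuations of $A$ with the topology generated by the sets $Spv(A)\left(\frac{x}{y}\right):=\{v\in Spv(A)\mid v(x)\le v(y)\neq0\}$, $x,y\in A$. A topological space is spectral if it is homeomorphic to the prime spectrum of a commutative ring with the Zariski topology. A map of spectral spaces is spectral if preimages of quasi-compact open sets are open and quasi-compact. The patch topology on a spectral space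 $X$ has as an open subbasis the quasi-compact open sets of $X$ and their complements. *)

(* Defs.v *)
From HB Require Import structures.
From mathcomp Require Import all_boot all_order all_algebra generic_quotient.
From mathcomp Require Import boolp classical_sets topology.
From mathcomp Require Import measurable_structure.

Set Implicit Arguments.
Unset Strict Implicit.
Unset Printing Implicit Defensive.

Import Order.TTheory GRing.Theory.

Local Open Scope classical_set_scope.
Local Open Scope quotient_scope.
Local Open Scope group_scope.

(* The axioms do not exclude [mzero = 1], i.e. the one-element monoid. *)
HB.mixin Record Monoid_isComMonoid0 M & monoid.Monoid M := {
  mzero : M ;
  mulmC : commutative (@monoid.mul M) ;
  mul0m : left_zero mzero (@monoid.mul M)
}.

#[short(type="comMonoid0Type")]
HB.structure Definition ComMonoid0 :=
  {M of Monoid_isComMonoid0 M & monoid.Monoid M}.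

HB.mixin Record UMagmaMorphism_isMonoid0Morphism (M N : comMonoid0Type)
    (f : M -> N) := {
  monoid0_morph0 : f mzero = mzero
}.

HB.structure Definition Monoid0Morphism (M N : comMonoid0Type) :=
  {f of UMagmaMorphism_isMonoid0Morphism M N f & @UMagmaMorphism M N f}.

Notation "{ 'monoid0' M -> N }" := (Monoid0Morphism.type M N)
  (at level 0, M at level 98, N at level 99,
   format "{ 'monoid0'  M  ->  N }") : type_scope.

Section Monoid0MorphismInstances.
Variables (M N P : comMonoid0Type).
Variables (g : {monoid0 N -> P}) (f : {monoid0 M -> N}).

Fact idfun_monoid0_morph0 : idfun mzero = mzero :> M. Proof. by []. Qed.

HB.instance Definition _ :=
  UMagmaMorphism_isMonoid0Morphism.Build M M idfun idfun_monoid0_morph0.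

Fact comp_monoid0_morph0 : (g \o f) mzero = mzero.
Proof. by rewrite /= !monoid0_morph0. Qed.

HB.instance Definition _ :=
  UMagmaMorphism_isMonoid0Morphism.Build M P (g \o f) comp_monoid0_morph0.
End Monoid0MorphismInstances.

Fact oag_display : Order.disp_t. Proof. exact: Order.Disp tt tt. Qed.

HB.mixin Record isOrderedAbelianGroup G
    & Group G & Order.Total oag_display G := {
  oag_mulgC : commutative (@monoid.mul G) ;
  oag_leM2r : forall z x y : G, (x <= y)%O -> (x * z <= y * z)%O
}.

#[short(type="oagType")]
HB.structure Definition OrderedAbelianGroup :=
  {G of isOrderedAbelianGroup G & Group G & Order.Total oag_display G}.

(* [None] is the adjoined zero. *)
Definition adjoin0 (G : Type) : Type := option G.

Section Adjoin0.
Variable G : oagType.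

Definition adjoin0_mul (x y : adjoin0 G) : adjoin0 G :=
  match x, y with Some a, Some b => Some (a * b) | _, _ => None end.

Definition adjoin0_le (x y : adjoin0 G) : bool :=
  match x, y with
  | None, _ => true
  | Some _, None => false
  | Some a, Some b => (a <= b)%O
  end.

Fact adjoin0_mulA : associative adjoin0_mul.
Proof. by move=> [a|] [b|] [c|] //=; rewrite mulgA. Qed.

Fact adjoin0_mul1 : left_id (Some 1) adjoin0_mul.
Proof. by move=> [a|] //=; rewrite mul1g. Qed.

Fact adjoin0_mulC : commutative adjoin0_mul.
Proof. by move=> [a|] [b|] //=; rewrite oag_mulgC. Qed.

Fact adjoin0_1mul : right_id (Some 1) adjoin0_mul.
Proof. by move=> x; rewrite adjoin0_mulC adjoin0_mul1. Qed.

Fact adjoin0_mul0 : left_zero None adjoin0_mul. Proof. by []. Qed.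

Fact adjoin0_le_anti : antisymmetric adjoin0_le.
Proof. by move=> [a|] [b|] //= /le_anti ->. Qed.

Fact adjoin0_le_trans : transitive adjoin0_le.
Proof. by move=> [a|] [b|] [c|] //=; apply: le_trans. Qed.

Fact adjoin0_le_total : total adjoin0_le.
Proof. by move=> [a|] [b|] //=; apply: le_total. Qed.

HB.instance Definition _ := Choice.copy (adjoin0 G) (option G).
HB.instance Definition _ := isMonoid.Build (adjoin0 G)
  adjoin0_mulA adjoin0_mul1 adjoin0_1mul.
HB.instance Definition _ := Monoid_isComMonoid0.Build (adjoin0 G)
  adjoin0_mulC adjoin0_mul0.
HB.instance Definition _ := Order.isOrder.Build oag_display (adjoin0 G)
  (fun _ _ => erefl) (fun _ _ => erefl) (fun _ _ => erefl)
  adjoin0_le_anti adjoin0_le_trans adjoin0_le_total.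
End Adjoin0.

(* A valuation is packed with its value group, so that [valuation A] is the
   type of all valuations of [A], whatever their value group. *)
Record valuation (A : comMonoid0Type) := Valuation {
  val_group : oagType ;
  val_fun :> {monoid0 A -> adjoin0 val_group}
}.

Definition val_comp (A B : comMonoid0Type) (v : valuation B)
  (f : {monoid0 A -> B}) : valuation A := Valuation (val_fun v \o f).

HB.instance Definition _ A := gen_eqMixin (valuation A).
HB.instance Definition _ A := gen_choiceMixin (valuation A).

(* [v] and [w] may take their values in different ordered groups. *)
Definition val_equiv (A : comMonoid0Type) (v w : valuation A) : Prop :=
  forall x y : A, (v x <= v y)%O <-> (w x <= w y)%O.

Definition val_equivb (A : comMonoid0Type) (v w : valuation A) : bool :=
  `[< val_equiv v w >].

Section ValEquiv.
Variable A : comMonoid0Type.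

Fact val_equivb_refl : reflexive (@val_equivb A).
Proof. by move=> v; apply/asboolP. Qed.

Fact val_equivb_sym : symmetric (@val_equivb A).
Proof. by move=> v w; apply/asboolP/asboolP=> e x y; rewrite e. Qed.

Fact val_equivb_trans : transitive (@val_equivb A).
Proof.
by move=> w v u /asboolP e1 /asboolP e2; apply/asboolP=> x y; rewrite e1.
Qed.

Definition val_equiv_rel : equiv_rel (valuation A) :=
  EquivRel (@val_equivb A) val_equivb_refl val_equivb_sym val_equivb_trans.
End ValEquiv.

Definition Spv (A : comMonoid0Type) : Type := {eq_quot val_equiv_rel A}.

HB.instance Definition _ A := Choice.copy (Spv A) {eq_quot val_equiv_rel A}.

Section Spv.
Variable A : comMonoid0Type.

Definition Spv_pi (v : valuation A) : Spv A := \pi_({eq_quot val_equiv_rel A}) v.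

Lemma Spv_piP (v w : valuation A) : Spv_pi v = Spv_pi w <-> val_equiv v w.
Proof.
split=> [/eqmodP /asboolP // | e].
by apply/eqmodP; apply/asboolP.
Qed.

Definition Spv_basic (a b : A) : set (Spv A) :=
  [set p | exists v : valuation A,
     [/\ p = Spv_pi v, (v a <= v b)%O & v b <> mzero]].

Definition Spv_subbasis : set (set (Spv A)) :=
  [set U | exists a b : A, U = Spv_basic a b].

HB.instance Definition _ :=
  isSubBaseTopological.Build (Spv A) Spv_subbasis id.
End Spv.

(* The class of [v] is sent to the class of [v \o f]: the choice of a
   representative is immaterial since [val_equiv] is compatible with [\o f]. *)
Definition Spv_map (A B : comMonoid0Type) (f : {monoid0 A -> B})
    (p : Spv B) : Spv A :=
  Spv_pi (val_comp (repr (p : {eq_quot val_equiv_rel B})) f).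

(* [comPzRingType] includes the zero ring, whose spectrum is empty; the
   library's [prime_idealr] only covers nonzero rings. *)
Definition prime_ideal (R : comPzRingType) (P : set R) : Prop :=
  [/\ P 0%R, forall x y, P x -> P y -> P (x + y)%R,
      forall a x, P x -> P (a * x)%R, ~ P 1%R
    & forall x y, P (x * y)%R -> P x \/ P y].

Definition Spec (R : comPzRingType) : Type := {P : set R | prime_ideal P}.

HB.instance Definition _ R := gen_eqMixin (Spec R).
HB.instance Definition _ R := gen_choiceMixin (Spec R).

Section Zariski.
Variable R : comPzRingType.

Definition zero_locus (E : set R) : set (Spec R) := [set P | E `<=` sval P].

Definition Zariski_open : set (set (Spec R)) :=
  [set U | exists E : set R, U = ~` zero_locus E].

Fact Zariski_openT : Zariski_open setT.
Proof.
exists [set 1%R]; apply/esym/seteqP; split=> // P _ EP.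
by have [_ _ _ + _] := svalP P; apply; apply: EP.
Qed.

Fact Zariski_openI : setI_closed Zariski_open.
Proof.
move=> _ _ [E ->] [F ->].
exists [set z | exists x y, [/\ E x, F y & z = (x * y)%R]].
rewrite -setCU; congr (~` _); apply/seteqP; split=> P /=.
  have [_ _ PM _ _] := svalP P.
  move=> [EP|FP] _ [x [y [Ex Fy ->]]]; last exact/PM/FP.
  by rewrite mulrC; apply/PM/EP.
move=> EFP; have [EP|/existsNP[x /not_implyP[Ex NPx]]] :=
  pselect (forall x, E x -> sval P x); first by left.
right=> y Fy; have [_ _ _ _ Pprime] := svalP P.
by have [//|//] := Pprime x y (EFP _ (ex_intro _ x (ex_intro _ y (And3 Ex Fy erefl)))).
Qed.

Fact Zariski_open_bigU (I : Type) (f : I -> set (Spec R)) :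
  (forall i, Zariski_open (f i)) -> Zariski_open (\bigcup_i f i).
Proof.
move=> /choice[E fE]; exists (\bigcup_i E i).
apply/seteqP; split=> P /=.
  by move=> [i _]; rewrite fE => NEP EP; apply: NEP => x Ex; apply: EP; exists i.
move=> NEP; apply: contrapT => Nf; apply: NEP => x [i _ Ex].
apply: contrapT => NPx; apply: Nf; exists i => //; rewrite fE => EP.
exact/NPx/EP.
Qed.

HB.instance Definition _ := isOpenTopological.Build (Spec R)
  Zariski_openT Zariski_openI Zariski_open_bigU.
End Zariski.

Definition homeomorphic (X Y : topologicalType) : Prop :=
  exists (f : X -> Y) (g : Y -> X),
    [/\ cancel f g, cancel g f, continuous f & continuous g].

Definition spectral_space (X : topologicalType) : Prop :=
  exists R : comPzRingType, homeomorphic X (Spec R).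

(* The library's [compact] does not require separation: it is
   quasi-compactness. *)
Definition qc_open (X : topologicalType) : set (set X) :=
  [set U | open U /\ compact U].

Definition spectral_map (X Y : topologicalType) (f : X -> Y) : Prop :=
  forall V : set Y, qc_open V -> qc_open (f @^-1` V).

(* An alias, so that [patch X] can carry another topology than [X]. *)
Definition patch (X : topologicalType) : Type := X.

HB.instance Definition _ X := Choice.on (patch X).
HB.instance Definition _ (X : topologicalType) :=
  isSubBaseTopological.Build (patch X)
    [set U : set (patch X) | @qc_open X U \/ @qc_open X (~` U)] id.

Definition boolean_subalgebra (T : Type) (G : set (set T)) : Prop :=
  [/\ G setT, setI_closed G & setC_closed G].

(* Main.v *)
From HB Require Import structures.
From mathcomp Require Import fraction qpoly generic_quotient finmap.
From mathcomp Require Import functions measurable_structure.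
Require Import Defs.
From mathcomp Require Import all_boot all_order all_algebra.
From mathcomp Require Import boolp classical_sets topology.

(** A point of [Spv A] is the same thing as a preorder on [A] of the form
    [v a <= v b]. These preorders are axiomatized by finitely many conditions
    on finitely many elements of [A] ([val_preorder], with the value group
    recovered by [val_preorder_valuation]), so an ultraproduct of such
    preorders is one again: every ultrafilter [F] on [Spv A] has a point
    belonging to exactly those sets [Spv_basic a b] that belong to [F]
    ([Spv_ultralimit]). This single compactness property of the subbasis,
    called [ultracomplete] below, carries the whole theorem.

    It makes every member of the Boolean algebra generated by the subbasis
    quasi-compact, and every quasi-compact open set lies in that algebra. The
    statements on bases, on the patch topology and on spectral maps follow,
    because [Spv_map f] pulls subbasic sets back to subbasic sets.

    There remains to find a ring whose spectrum is a given T0 space [X] with an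
    ultracomplete open subbasis [G]; this is Hochster's theorem. Take a field
    [K] of rational functions with one variable [t_U] for each [U] in [G]. For
    a set [S] of variables, multiply the variables of [S] by a new parameter
    [u] and let [u] tend to [0]: this defines a place of [K], that is a partial
    specialization [x ~> y] on [K] compatible with the field operations
    ([specialization_field]). The ring consists of the functions [a : X -> K]
    that are locally constant for the patch topology and such that [a x]
    specializes to [a y], along the set of those [U] that contain [x] but not
    [y], whenever [y] is in the closure of [x]. Four facts make its spectrum
    equal to [X].
    - The nonvanishing set of a section is stable under generization, because
      an element specializing to a nonzero element is nonzero; being
      constructible, it is open ([open_nonzero]).
    - The function equal to [t_U] on [U] and to [0] elsewhere is a section, so
      each [U] in [G] is a nonvanishing set.
    - If [a] vanishes wherever [b] does, then [b] divides a power of [a]: the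
      quotient of [a ^+ n] by [b], extended by [0], is a section as soon as [n]
      exceeds the orders of vanishing of [b] along all the places, which are
      bounded because [b] takes finitely many values and each value is a
      quotient of polynomials of bounded degree ([section_dvd]).
    - [K] is formally real, so the common zeros of [b] and [b'] are the zeros
      of [b ^+ 2 + b' ^+ 2].
    The last two facts show that the zero set and the nonvanishing sets
    attached to a prime ideal have the finite intersection property, so they
    meet in a point, and the prime ideal is the ideal of sections vanishing
    there ([prime_vanishing]). *)

Set Implicit Arguments.
Unset Strict Implicit.
Unset Printing Implicit Defensive.

Local Open Scope classical_set_scope.

(** * Valuations up to equivalence are preorders *)

Section ValuationPreorder.
Variable A : comMonoid0Type.
Local Open Scope group_scope.
Local Notation "0" := (mzero : A).

(** The first-order properties of the relation [v a <= v b]. Cancellation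
    with [b = 0] says that the kernel of [v] is a prime ideal. *)
Record val_preorder (le : A -> A -> Prop) : Prop := ValPreorder {
  vpo_total : forall a b, le a b \/ le b a ;
  vpo_trans : forall b a c, le a b -> le b c -> le a c ;
  vpo_min : forall a, le 0 a ;
  vpo_mul : forall c a b, le a b -> le (a * c) (b * c) ;
  vpo_cancel : forall c a b, ~ le c 0 -> le (a * c) (b * c) -> le a b ;
  vpo_one : ~ le 1 0
}.

(** The value group is the group of fractions of the elements outside the
    kernel, ordered by cross multiplication, modulo the equivalence attached to
    this preorder. *)
Section ValueGroup.
Variables (le : A -> A -> Prop) (leP : val_preorder le).

Let le_refl a : le a a. Proof. by case: (vpo_total leP a a). Qed.

Let mulmAC (a b c : A) : a * b * c = a * c * b.
Proof. by rewrite -!mulgA [b * c]mulmC. Qed.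

Let nz (a : A) : bool := `[< ~ le a 0 >].

Let nz1 : nz 1. Proof. exact/asboolP/(vpo_one leP). Qed.

Let nzM a b : nz a -> nz b -> nz (a * b).
Proof.
move=> /asboolP na /asboolP nb; apply/asboolP => lab; apply: na.
by apply: (vpo_cancel leP nb); rewrite mul0m.
Qed.

Let nzMl a b : nz (a * b) -> nz a.
Proof.
move=> /asboolP nab; apply/asboolP => la; apply: nab.
by have := vpo_mul leP b la; rewrite mul0m.
Qed.

(* [(a, b)] stands for the fraction [a / b]. *)
Let frac_nz (p : A * A) : bool := nz p.1 && nz p.2.
Let frac_le (p q : A * A) : bool := `[< le (p.1 * q.2) (q.1 * p.2) >].
Let frac_eq (p q : A * A) : bool := frac_le p q && frac_le q p.

Let frac_le_trans p q r : frac_nz q ->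
  frac_le p q -> frac_le q r -> frac_le p r.
Proof.
case: p q r => [a b] [c d] [e f] /andP[/asboolP nc /asboolP nd].
move=> /asboolP/= h1 /asboolP/= h2; apply/asboolP => /=.
apply: (vpo_cancel leP nd).
have {}h1 := vpo_mul leP f h1; have {}h2 := vpo_mul leP b h2.
rewrite mulmAC; apply: (vpo_trans leP h1).
by rewrite mulmAC [e * b * d]mulmAC.
Qed.

Let frac_le_total p q : frac_le p q || frac_le q p.
Proof.
by apply/orP; case: (vpo_total leP (p.1 * q.2) (q.1 * p.2)) => h;
  [left|right]; apply/asboolP.
Qed.

Let frac_eqxx p : frac_eq p p.
Proof. by have := frac_le_total p p; rewrite orbb /frac_eq => ->. Qed.

Let frac_eq_sym p q : frac_eq p q = frac_eq q p.
Proof. by rewrite /frac_eq andbC. Qed.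

Let frac_eq_trans p q r : frac_nz q ->
  frac_eq p q -> frac_eq q r -> frac_eq p r.
Proof.
move=> nq /andP[pq qp] /andP[qr rq].
by rewrite /frac_eq (frac_le_trans nq pq qr) (frac_le_trans nq rq qp).
Qed.

(* Each class of fractions is represented by a chosen element of it, so that the
   value group is a subtype of [A * A]: the group must live in the universe of
   [A], which is smaller than the one of sets of fractions. *)
Let frac_class (p : A * A) : pred (A * A) := fun q => frac_nz q && frac_eq p q.

Let canon (p : A * A) : A * A := choose (frac_class p) p.

Let canonP p : frac_nz p -> frac_nz (canon p) /\ frac_eq p (canon p).
Proof.
move=> np; have : frac_class p (canon p).
  by apply: chooseP; rewrite /frac_class np frac_eqxx.
by move=> /andP.
Qed.

Let canon_nz p : frac_nz p -> frac_nz (canon p).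
Proof. by case/canonP. Qed.

Let canon_eq p q : frac_nz p -> frac_nz q -> frac_eq p q -> canon p = canon q.
Proof.
move=> np nq pq; rewrite /canon.
have cE : frac_class p =1 frac_class q.
  move=> r; rewrite /frac_class; case nr : (frac_nz r) => //=.
  apply/idP/idP; last exact: frac_eq_trans.
  by apply: frac_eq_trans => //; rewrite frac_eq_sym.
rewrite (eq_choose cE); apply: choose_id; rewrite -?cE /frac_class.
  by rewrite np frac_eqxx.
by rewrite nq pq.
Qed.

Let canonK p : frac_nz p -> canon (canon p) = canon p.
Proof.
move=> np; have [nc ec] := canonP np; apply: canon_eq => //.
by rewrite frac_eq_sym.
Qed.

Definition value_group : Type :=
  {p : A * A | frac_nz p && (canon p == p)}.

HB.instance Definition _ := Choice.copy value_group
  {p : A * A | frac_nz p && (canon p == p)}.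

Let class (p : A * A) (np : frac_nz p) : value_group.
Proof.
by exists (canon p); rewrite canon_nz //= canonK.
Defined.

Let nzP (x : value_group) : frac_nz (sval x).
Proof. by case: x => /= p /andP[]. Qed.

Let sval_canon (x : value_group) : canon (sval x) = sval x.
Proof. by case: x => /= p /andP[_ /eqP]. Qed.

Let class_sval (x : value_group) (np : frac_nz (sval x)) : class np = x.
Proof. by apply: val_inj; rewrite /= sval_canon. Qed.

Let class_eq p q (np : frac_nz p) (nq : frac_nz q) :
  frac_eq p q -> class np = class nq.
Proof. by move=> pq; apply: val_inj; apply: canon_eq. Qed.

Let frac_mul (p q : A * A) := (p.1 * q.1, p.2 * q.2).
Let frac_inv (p : A * A) := (p.2, p.1).

Let frac_mul_nz p q : frac_nz p -> frac_nz q -> frac_nz (frac_mul p q).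
Proof.
by move=> /andP[? ?] /andP[? ?]; apply/andP; split; apply: nzM.
Qed.

Let frac_inv_nz p : frac_nz p -> frac_nz (frac_inv p).
Proof. by rewrite /frac_nz andbC. Qed.

Let one_nz : frac_nz (1, 1). Proof. by rewrite /frac_nz nz1. Qed.

Let mulACA (a b c d : A) : (a * b) * (c * d) = (a * c) * (b * d).
Proof. by rewrite -!mulgA; congr (_ * _); rewrite !mulgA [b * c]mulmC. Qed.

Let frac_le_mul p q r : frac_le p q -> frac_le (frac_mul p r) (frac_mul q r).
Proof.
move=> /asboolP h; apply/asboolP => /=.
by rewrite mulACA [q.1 * r.1 * _]mulACA; apply: vpo_mul.
Qed.

Let frac_eq_mul p q r : frac_eq p q -> frac_eq (frac_mul p r) (frac_mul q r).
Proof. by move=> /andP[pq qp]; rewrite /frac_eq !frac_le_mul. Qed.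

Let frac_mulC p q : frac_mul p q = frac_mul q p.
Proof. by rewrite /frac_mul mulmC [p.2 * _]mulmC. Qed.

Let frac_mulA p q r : frac_mul p (frac_mul q r) = frac_mul (frac_mul p q) r.
Proof. by rewrite /frac_mul /= !mulgA. Qed.

Let vg_mul (x y : value_group) : value_group :=
  class (frac_mul_nz (nzP x) (nzP y)).
Let vg_one : value_group := class one_nz.
Let vg_inv (x : value_group) : value_group := class (frac_inv_nz (nzP x)).
Let vg_le (x y : value_group) : bool := frac_le (sval x) (sval y).

Let sval_class p (np : frac_nz p) : frac_eq (sval (class np)) p.
Proof. by have [_] := canonP np; rewrite frac_eq_sym. Qed.

Let vg_mulC : commutative vg_mul.
Proof.
by move=> x y; apply: class_eq; rewrite frac_mulC.
Qed.

Let classM p q (np : frac_nz p) (nq : frac_nz q)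
    (npq : frac_nz (frac_mul p q)) :
  vg_mul (class np) (class nq) = class npq.
Proof.
apply: class_eq; apply: (frac_eq_trans (q := frac_mul p (sval (class nq)))).
- exact/frac_mul_nz/nzP.
- exact/frac_eq_mul/sval_class.
- by rewrite frac_mulC [frac_mul p q]frac_mulC; apply/frac_eq_mul/sval_class.
Qed.

Let vg_mulA : associative vg_mul.
Proof.
move=> x y z; rewrite -(class_sval (nzP x)) -(class_sval (nzP y)).
rewrite -(class_sval (nzP z)).
have nyz := frac_mul_nz (nzP y) (nzP z).
have nxy := frac_mul_nz (nzP x) (nzP y).
rewrite (classM _ _ nyz) (classM _ _ nxy) !classM; try exact: frac_mul_nz.
by move=> n1 n2; apply: class_eq; rewrite frac_mulA.
Qed.

Let vg_mul1 : left_id vg_one vg_mul.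
Proof.
move=> x; rewrite -(class_sval (nzP x)) classM; first exact: frac_mul_nz.
by move=> n; apply: class_eq; rewrite /frac_mul !mul1g; case: (sval x).
Qed.

Let vg_mulV : left_inverse vg_one vg_inv vg_mul.
Proof.
move=> x; rewrite -[X in vg_mul _ X](class_sval (nzP x)) classM.
  exact/frac_mul_nz/nzP/frac_inv_nz.
move=> n; apply: class_eq; rewrite /frac_eq /frac_le /= !mulg1 !mul1g.
by rewrite mulmC andbb; apply/asboolP.
Qed.

Let vg_le_anti : antisymmetric vg_le.
Proof.
move=> x y xy; apply: val_inj; rewrite /= -[LHS]sval_canon -[RHS]sval_canon.
by apply: canon_eq xy; apply: nzP.
Qed.

Let vg_le_trans : transitive vg_le.
Proof. by move=> y x z; apply: frac_le_trans. Qed.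

Let vg_le_total : total vg_le.
Proof. by move=> x y; apply: frac_le_total. Qed.

HB.instance Definition _ := isGroup.Build value_group vg_mulA vg_mul1
  (fun x => etrans (vg_mulC x vg_one) (vg_mul1 x)) vg_mulV
  (fun x => etrans (vg_mulC x (vg_inv x)) (vg_mulV x)).

HB.instance Definition _ := Order.isOrder.Build oag_display value_group
  (fun _ _ => erefl) (fun _ _ => erefl) (fun _ _ => erefl)
  vg_le_anti vg_le_trans vg_le_total.

Let vg_leM2r (z x y : value_group) : (x <= y)%O -> (x * z <= y * z)%O.
Proof.
move=> xy; rewrite /Order.le /=.
have /andP[h _] := sval_class (frac_mul_nz (nzP x) (nzP z)).
have /andP[_ h'] := sval_class (frac_mul_nz (nzP y) (nzP z)).
apply: frac_le_trans h _; first exact: frac_mul_nz.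
apply: frac_le_trans h'; first exact: frac_mul_nz.
exact: frac_le_mul.
Qed.

HB.instance Definition _ := isOrderedAbelianGroup.Build value_group
  vg_mulC vg_leM2r.

Let nz_frac a : nz a -> frac_nz (a, 1).
Proof. by move=> na; rewrite /frac_nz /= na nz1. Qed.

Let vfun (a : A) : adjoin0 value_group :=
  if @idP (nz a) is ReflectT na then Some (class (nz_frac na)) else None.

Let vfunT a (na : nz a) : vfun a = Some (class (nz_frac na)).
Proof.
rewrite /vfun; case: {-}_ / idP => [na'|//].
by congr Some; apply: class_eq.
Qed.

Let vfunF a : ~~ nz a -> vfun a = None.
Proof. by move=> /negP na; rewrite /vfun; case: {-}_ / idP. Qed.

Let vfun1 : vfun 1 = 1.
Proof. by rewrite (vfunT nz1); congr Some; apply: class_eq. Qed.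

Let vfun0 : vfun mzero = mzero.
Proof. by rewrite vfunF //; apply/asboolPn => /(_ (le_refl _)). Qed.

Let vfunM a b : vfun (a * b) = vfun a * vfun b.
Proof.
have [na|na] := boolP (nz a); last first.
  rewrite (vfunF na) vfunF //; by apply: contra na; exact: nzMl.
have [nb|nb] := boolP (nz b); last first.
  rewrite (vfunF nb) vfunF ?(vfunT na) //.
  by apply: contra nb; rewrite mulmC; exact: nzMl.
rewrite (vfunT na) (vfunT nb) (vfunT (nzM na nb)); congr Some.
rewrite [RHS]classM; first exact/frac_mul_nz/nz_frac/nb/nz_frac.
by move=> n; apply: class_eq; rewrite /frac_mul /= mulg1.
Qed.

HB.instance Definition _ := isUMagmaMorphism.Build A (adjoin0 value_group) vfun
  (conj vfun1 vfunM).
HB.instance Definition _ :=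
  UMagmaMorphism_isMonoid0Morphism.Build A (adjoin0 value_group) vfun vfun0.

(** The valuation sends [a] to the class of [a / 1], or to zero when [a] is in
    the kernel. *)
Lemma val_preorder_valuation :
  exists v : valuation A, forall a b, (v a <= v b)%O <-> le a b.
Proof.
exists (@Valuation A value_group vfun) => a b /=.
have [na|na] := boolP (nz a); last first.
  rewrite (vfunF na); split=> // _; apply: (vpo_trans leP (b := mzero)).
    by move/asboolPn/contrapT: na.
  exact: vpo_min.
have [nb|nb] := boolP (nz b); last first.
  rewrite (vfunT na) (vfunF nb); split=> // lab.
  have /asboolP[] := na; apply: (vpo_trans leP lab).
  by move/asboolPn/contrapT: nb.
have /andP[ca ac] := sval_class (nz_frac na).
have /andP[cb bc] := sval_class (nz_frac nb).
rewrite (vfunT na) (vfunT nb).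
have -> : (Some (class (nz_frac na)) <= Some (class (nz_frac nb)) :> adjoin0 _)%O
          = frac_le (a, 1) (b, 1).
  apply/idP/idP => h.
    apply: frac_le_trans ac _; first exact: nzP.
    by apply: frac_le_trans h cb; exact: nzP.
  apply: frac_le_trans ca _; first exact: nz_frac.
  by apply: frac_le_trans h bc; exact: nz_frac.
by rewrite -[X in _ <-> X]asboolE /frac_le /= !mulg1.
Qed.

End ValueGroup.
End ValuationPreorder.

Local Open Scope quotient_scope.

(** * Points of the valuation spectrum *)

Section SpvPoints.
Variable A : comMonoid0Type.

Definition spv_le (p : Spv A) (a b : A) : Prop :=
  (val_fun (repr (p : {eq_quot val_equiv_rel A})) a
     <= val_fun (repr (p : {eq_quot val_equiv_rel A})) b)%O.

Lemma Spv_pi_repr (p : Spv A) :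
  Spv_pi (repr (p : {eq_quot val_equiv_rel A})) = p.
Proof. exact: reprK. Qed.

Lemma spv_le_pi (v : valuation A) a b : spv_le (Spv_pi v) a b <-> (v a <= v b)%O.
Proof. by have /Spv_piP := Spv_pi_repr (Spv_pi v); apply. Qed.

Lemma spv_le_inj (p q : Spv A) :
  (forall a b, spv_le p a b <-> spv_le q a b) -> p = q.
Proof.
by move=> pq; rewrite -(Spv_pi_repr p) -(Spv_pi_repr q); apply/Spv_piP.
Qed.

Lemma valuation_preorder (v : valuation A) :
  val_preorder (fun a b : A => (v a <= v b)%O).
Proof.
split=> [a b|b a c|a|c a b|c a b|].
- exact/orP/Order.TotalTheory.le_total.
- exact: Order.POrderTheory.le_trans.
- by rewrite monoid0_morph0.
- rewrite !gmulfM /=; case: (v a) (v b) (v c) => [x|] [y|] [z|] //.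
  exact: oag_leM2r.
- rewrite !gmulfM monoid0_morph0 /=; case: (v a) (v b) (v c) => [x|] [y|] [z|] //=.
  move=> _ xzyz; have := @oag_leM2r (val_group v) z^-1%g _ _ xzyz.
  by rewrite !mulgK.
- by rewrite gmulf1 monoid0_morph0.
Qed.

Lemma spv_preorder (p : Spv A) : val_preorder (spv_le p).
Proof. exact: valuation_preorder. Qed.

Lemma Spv_basicE (a b : A) :
  Spv_basic a b = [set p | spv_le p a b /\ ~ spv_le p b mzero].
Proof.
have nz (v : valuation A) : v b <> mzero <-> ~ (v b <= v mzero)%O.
  rewrite monoid0_morph0; split; last by move=> + vb; rewrite vb.
  by move=> + vb; apply; move: vb; case: (v b).
apply/seteqP; split=> [p [v [-> vab /nz nvb]]|p].
  by split; [apply/spv_le_pi|move/spv_le_pi].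
rewrite -(Spv_pi_repr p); set v := repr _ => -[/spv_le_pi vab nvb].
by exists v; split=> //; apply/nz => /spv_le_pi.
Qed.

(** The condition [v a <= v b] is not of the form of a subbasic set when
    [v b = 0]; it then means [v a = 0], which is the complement of the subbasic
    set of the pair [(a, a)]. *)
Lemma spv_le_basic (p : Spv A) a b :
  spv_le p a b <-> Spv_basic a b p \/ ~ Spv_basic a a p.
Proof.
have [tot tr m _ _ _] := spv_preorder p.
have aa : spv_le p a a by case: (tot a a).
rewrite !Spv_basicE; split=> /=.
  move=> ab; have [bz|bz] := pselect (spv_le p b mzero); last by left.
  by right=> -[_]; apply; apply: tr bz.
case=> [[] //|naa]; apply: (tr mzero) => //; apply: contrapT => az; exact: naa.
Qed.

Lemma Spv_basic_separated (p q : Spv A) :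
  (forall a b, Spv_basic a b p <-> Spv_basic a b q) -> p = q.
Proof. by move=> pq; apply: spv_le_inj => a b; rewrite !spv_le_basic !pq. Qed.

(** The relation [v a <= v b] for [F]-almost all [v] inherits the axioms of
    [val_preorder]; totality, cancellation and the treatment of negations use
    that [F] is an ultrafilter. *)
Lemma Spv_ultralimit (F : set_system (Spv A)) : UltraFilter F ->
  exists p : Spv A, forall a b, Spv_basic a b p <-> F (Spv_basic a b).
Proof.
move=> UF; have PF := @ultra_proper _ _ UF.
pose le a b := F [set q | spv_le q a b].
have leP : val_preorder le.
  split=> [a b|b a c h1 h2|a|c a b h|c a b h1 h2|h].
  - case: (in_ultra_setVsetC [set q | spv_le q a b] UF) => h; [by left|right].
    by apply: filterS h => q /= nab; case: (vpo_total (spv_preorder q) a b).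
  - by apply: filterS2 h1 h2 => q /=; apply: (vpo_trans (spv_preorder q)).
  - by apply: filterE => q; apply: (vpo_min (spv_preorder q)).
  - by apply: filterS h => q /=; apply: (vpo_mul (spv_preorder q)).
  - case: (in_ultra_setVsetC [set q | spv_le q c mzero] UF) => // h3.
    by apply: filterS2 h3 h2 => q /=; apply: (vpo_cancel (spv_preorder q)).
  - apply: (filter_not_empty F); apply: filterS h => q /=.
    exact: (vpo_one (spv_preorder q)).
have [v vP] := val_preorder_valuation leP.
exists (Spv_pi v) => a b; rewrite Spv_basicE /= !spv_le_pi !vP.
split=> [[h1 h2]|h].
  case: (in_ultra_setVsetC [set q | spv_le q b mzero] UF) => // h3.
  by apply: filterS2 h1 h3 => q.
split; first by apply: filterS h => q [].
move=> h2; apply: (filter_not_empty F); apply: filterS2 h h2 => q [_].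
exact.
Qed.
End SpvPoints.

(** * Spaces with an ultracomplete subbasis *)

Lemma subbase_basis (X : topologicalType) (G : set (set X)) :
  (forall W, open W <->
    exists2 D, D `<=` finI_from G id & \bigcup_(V in D) V = W) ->
  basis (finI_from G id).
Proof.
move=> openG; split=> [V GV|x W].
  apply/openG; exists [set V]; last by rewrite bigcup_set1.
  by move=> _ ->.
rewrite nbhsE => -[V [/openG [D DG <-] [V' DV' V'x]] VW].
exists V'; first by split=> //; apply: DG.
by move=> y V'y; apply: VW; exists V'.
Qed.

Lemma finI_fromT (T : Type) (G : set (set T)) : finI_from G id setT.
Proof. by exists fset0 => //; rewrite set_fset0 bigcap_set0. Qed.

Lemma finI_from_ind (T : Type) (G P : set (set T)) :
  P setT -> setI_closed P -> G `<=` P -> finI_from G id `<=` P.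
Proof.
move=> PT PI GP _ [D DG <-]; rewrite bigcap_fset.
rewrite big_seq; elim/big_ind: _ => // V /DG.
by rewrite inE; apply: GP.
Qed.

Section Constructible.
Variable T : Type.
Implicit Types G : set (set T).

Definition constructible G : set (set T) := smallest (@boolean_subalgebra T) G.

Lemma sub_constructible G : G `<=` constructible G.
Proof. exact: sub_gen_smallest. Qed.

Lemma constructible_ind G (P : set (set T)) :
  P setT -> setI_closed P -> setC_closed P -> G `<=` P ->
  constructible G `<=` P.
Proof. by move=> PT PI PC GP; apply: smallest_sub => //; split. Qed.

Lemma constructibleT G : constructible G setT.
Proof. by move=> B [[BT _ _] _]. Qed.

Lemma constructibleI G : setI_closed (constructible G).
Proof.
move=> C D cC cD B hB; have [[_ BI _] _] := hB.
by apply: BI; [apply: cC|apply: cD].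
Qed.

Lemma constructibleC G : setC_closed (constructible G).
Proof. by move=> C cC B hB; have [[_ _ BC] _] := hB; apply: BC; apply: cC. Qed.

Lemma constructible0 G : constructible G set0.
Proof. by rewrite -setCT; apply: constructibleC; apply: constructibleT. Qed.

Lemma constructibleU G : setU_closed (constructible G).
Proof.
move=> C D cC cD; rewrite -[_ `|` _]setCK setCU.
by apply: constructibleC; apply: constructibleI; apply: constructibleC.
Qed.

Lemma constructible_finI G : finI_from G id `<=` constructible G.
Proof.
by apply: finI_from_ind;
  [exact: constructibleT|exact: constructibleI|exact: sub_constructible].
Qed.

(** A limit for the topology whose subbasis consists of the members of [G] and
    their complements. *)
Definition ultralimit G (F : set_system T) (x : T) : Prop :=
  forall U, G U -> (U x <-> F U).

Lemma ultralimit_constructible G (F : set_system T) x : UltraFilter F ->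
  ultralimit G F x -> ultralimit (constructible G) F x.
Proof.
move=> UF Fx; have PF := @ultra_proper _ _ UF.
apply: constructible_ind => //.
- by split=> // _; apply: filterT.
- move=> C D /= hC hD; split; first by move=> [/hC ? /hD ?]; apply: filterI.
  by move=> h; split; [apply/hC|apply/hD]; apply: filterS h;
    [exact: subIsetl|exact: subIsetr].
- move=> C /= hC; split=> [nCx|FnC /hC FC].
    by case: (in_ultra_setVsetC C UF) => // /hC.
  have F0 : F set0 by rewrite -(setICr C); apply: filterI.
  exact: filter_not_empty F0.
Qed.

(** Quasi-compactness of the topology generated by [G] and the complements of
    its members. *)
Definition ultracomplete G : Prop :=
  forall F : set_system T, UltraFilter F -> exists x, ultralimit G F x.

(** The compactness argument in the form used below: a family [B] with the
    finite intersection property is contained in an ultrafilter, whose limit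
    decides membership in all constructible sets. *)
Lemma ultracomplete_filter G (B : set (set T)) : ultracomplete G ->
  B setT -> setI_closed B -> ~ B set0 ->
  exists F x, [/\ UltraFilter F, ultralimit (constructible G) F x & B `<=` F].
Proof.
move=> ucG BT BI B0.
have PF : ProperFilter (filter_from B id).
  apply: filter_from_proper; first apply: filter_from_filter.
  - by exists setT.
  - by move=> C D BC BD; exists (C `&` D) => //; apply: BI.
  - by move=> C BC; apply/set0P/eqP => C0; apply: B0; rewrite -C0.
have [F [UF BF]] := @ultraFilterLemma _ _ PF.
have [x Fx] := ucG F UF; exists F, x; split=> //.
  exact: ultralimit_constructible.
by move=> C BC; apply: BF; exists C.
Qed.
End Constructible.

Section UltracompleteSubbasis.
Variables (X : topologicalType) (G : set (set X)).
Hypotheses (basisG : basis (finI_from G id)) (ucG : ultracomplete G).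

Lemma ultralimit_cvg (F : set_system X) x : UltraFilter F ->
  ultralimit (constructible G) F x -> F --> x.
Proof.
move=> UF Fx W /(basisG.2 x)[V [GV Vx] VW].
have cV := constructible_finI GV.
by apply: filterS VW _; apply/(Fx V cV).
Qed.

Lemma compact_constructible : constructible G `<=` @compact X.
Proof.
move=> C cC; rewrite compact_ultra => F UF FC.
have [x Fx] := ucG UF; have {}Fx := ultralimit_constructible UF Fx.
by exists x; split; [exact/(Fx C cC)|exact: ultralimit_cvg].
Qed.

Lemma qc_open_finI : finI_from G id `<=` @qc_open X.
Proof.
move=> V GV; split; first exact: basisG.1.
by apply: compact_constructible; apply: constructible_finI.
Qed.

(** If [V] were not constructible, the differences of [V] with its constructible
    subsets would have the finite intersection property, and an ultrafilter
    containing them has no limit in [V]. *)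
Lemma constructible_qc_open : @qc_open X `<=` constructible G.
Proof.
move=> V [oV cptV].
pose B := [set D | exists W, [/\ constructible G W, W `<=` V & V `\` W `<=` D]].
have [[W [cW WV]]|B0] := pselect (B set0).
  by rewrite subset0 setD_eq0 => VW; have -> : V = W by apply/seteqP.
have PF : ProperFilter B.
  split=> //; split.
  - exists set0; split=> //.
    exact: constructible0.
  - move=> C D [W [cW WV WC]] [W' [cW' W'V W'D]].
    exists (W `|` W'); split; first exact: constructibleU.
      by rewrite subUset.
    by move=> x [Vx /not_orP[nW nW']]; split; [apply: WC|apply: W'D].
  - by move=> C D CD [W [cW WV WC]]; exists W; split=> //; apply: subset_trans CD.
have [F [UF BF]] := @ultraFilterLemma _ _ PF.
have FV : F V by apply: BF; exists set0; split; rewrite ?setD0 //;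
  exact: constructible0.
move: cptV; rewrite compact_ultra => /(_ F UF FV) [x [Vx Fx]].
have [W [GW Wx] WV] := basisG.2 x V (open_nbhs_nbhs (conj oV Vx)).
have FW : F W by apply: Fx; apply: open_nbhs_nbhs; split=> //; apply: basisG.1.
have FD : F (V `\` W).
  by apply: BF; exists W; split=> //; apply: constructible_finI.
exfalso; apply: (filter_not_empty F).
by apply: filterS (filterI FW FD) => y [? []].
Qed.

(** Quasi-compact open sets and their complements are constructible, and
    conversely each constructible set is clopen for the patch topology. *)
Lemma basis_patch_constructible : @basis (patch X) (constructible G).
Proof.
have bp : @basis (patch X)
    (finI_from [set U | @qc_open X U \/ @qc_open X (~` U)] id).
  by apply: subbase_basis => W.
have GU U : G U -> @qc_open X U by move=> GU; apply: qc_open_finI; apply: finI_from1.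
split=> [C cC|x W /(bp.2 x)[V [pV Vx] VW]]; last first.
  exists V => //; split=> //; move: V pV {Vx VW}; apply: finI_from_ind.
  - exact: constructibleT.
  - exact: constructibleI.
  - move=> U [qU|qU]; first exact: constructible_qc_open.
    rewrite -[U]setCK; apply: constructibleC; exact: constructible_qc_open.
suff [] : @open (patch X) C /\ @open (patch X) (~` C) by [].
move: C cC; apply: constructible_ind.
- by rewrite setCT; split; [apply: openT|apply: open0].
- by move=> C D [oC oC'] [oD oD']; rewrite setCI; split;
    [apply: openI|apply: openU].
- by move=> C [oC oC']; rewrite setCK.
- move=> U /GU qU; split; apply: bp.1; apply: finI_from1; first by left.
  by right; rewrite setCK.
Qed.
End UltracompleteSubbasis.

Lemma spectral_map_subbasis (X Y : topologicalType) (G : set (set X))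
    (H : set (set Y)) (f : X -> Y) :
  basis (finI_from G id) -> ultracomplete G -> basis (finI_from H id) ->
  (forall V, H V -> G (f @^-1` V)) -> spectral_map f.
Proof.
move=> bG ucG bH fHG V qV; have [oV _] := qV; split.
  rewrite openE => x /= Vx.
  have [W [HW Wx] WV] := bH.2 (f x) V (open_nbhs_nbhs (conj oV Vx)).
  apply: (@filterS _ _ _ (f @^-1` W)); first by move=> y /WV.
  apply: open_nbhs_nbhs; split=> //; apply: bG.1.
  move: W HW {Wx WV}; apply: finI_from_ind => [|W W'|W /fHG].
  - exact: finI_fromT.
  - exact: finI_fromI.
  - exact: finI_from1.
apply: (compact_constructible bG ucG).
have cV := constructible_qc_open bH qV.
move: V cV {qV oV}; apply: constructible_ind.
- exact: constructibleT.
- by move=> W W'; apply: constructibleI.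
- by move=> W; apply: constructibleC.
- by move=> W /fHG; apply: sub_constructible.
Qed.

Import GRing.Theory Num.Theory.
Local Open Scope ring_scope.

(** * Polynomial functions in arbitrarily many variables *)

Lemma poly_inj_horner (R : numDomainType) (f g : {poly R}) :
  (forall x, f.[x] = g.[x]) -> f = g.
Proof.
move=> fg; apply/eqP; rewrite -subr_eq0; apply/eqP; apply: contraTeq isT => nz.
pose s := [seq i%:R : R | i <- iota 0 (size (f - g))].
have /= := max_poly_roots nz (rs := s).
rewrite map_inj_uniq ?iota_uniq ?size_map ?size_iota ?ltnn; last first.
  by move=> i j /eqP; rewrite eqr_nat => /eqP.
by move=> ->//; apply/allP => x _; rewrite /root hornerD hornerN fg subrr.
Qed.

(** By Lagrange interpolation at [0, ..., n], each coefficient of a polynomial of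
    degree at most [n] is a fixed linear combination of its values. *)
Lemma coef_interpolation (R : numFieldType) (n k : nat) :
  exists L : nat -> R, forall h : {poly R}, (size h <= n.+1)%N ->
    h`_k = \sum_(j < n.+1) L j * h.[j%:R].
Proof.
pose x (j : nat) : R := j%:R.
have x_inj : injective x by move=> i j /eqP; rewrite eqr_nat => /eqP.
exists (fun j => (tnth (lagrange n.+1 x) (inord j) : {poly R})`_k) => h hn.
rewrite {1}(lagrange_gen (ltn0Sn n) x_inj hn) coef_sum; apply: eq_bigr => j _.
by rewrite coefCM inord_val mulrC.
Qed.

Section PolynomialFunctions.
Variable I : Type.
Local Notation point := (I -> rat).
Implicit Types (p q : point) (S : set I).

Definition line p q (s : rat) : point := fun i => p i + s * q i.

(** Polynomials in the variables [I] are encoded as functions on [I -> rat] whose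
    restrictions to lines are polynomials of bounded degree. Everything needed
    about them can be tested on lines, even for infinite [I]. *)
Definition polyfun_le n (F : point -> rat) :=
  forall p q, exists h : {poly rat},
    (size h <= n.+1)%N /\ forall s, F (line p q s) = h.[s].

Definition polyfun : {pred point -> rat} :=
  fun F => `[< exists n, polyfun_le n F >].

Lemma polyfun_subring : subring_closed polyfun.
Proof.
split=> [|F G /asboolP[m Fm] /asboolP[n Gn]|F G /asboolP[m Fm] /asboolP[n Gn]].
- apply/asboolP; exists 0%N => p q; exists 1%:P.
  by rewrite size_poly1; split=> // s; rewrite hornerC.
- apply/asboolP; exists (maxn m n) => p q.
  have [f [fm fE]] := Fm p q; have [g [gn gE]] := Gn p q.
  exists (f - g); split=> [|s].
    apply: leq_trans (size_polyD _ _) _; rewrite size_polyN.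
    by rewrite -maxnSS geq_max !leq_max fm gn orbT.
  by rewrite hornerD hornerN -fE -gE.
- apply/asboolP; exists (m + n)%N => p q.
  have [f [fm fE]] := Fm p q; have [g [gn gE]] := Gn p q.
  exists (f * g); split=> [|s]; last by rewrite hornerM -fE -gE.
  apply: leq_trans (size_polyMleq _ _) _.
  by have := leq_add fm gn; rewrite addSn addnS; case: (_ + _)%N.
Qed.

HB.instance Definition _ :=
  GRing.isSubringClosed.Build (point -> rat) polyfun polyfun_subring.

Definition polyFun : Type := {F : point -> rat | F \in polyfun}.
HB.instance Definition _ := SubType.copy polyFun {F : point -> rat | F \in polyfun}.
HB.instance Definition _ := [Choice of polyFun by <:].
HB.instance Definition _ := 
  GRing.SubChoice_isSubComPzRing.Build _ _ polyFun polyfun_subring.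

Definition PolyFun F (PF : F \in polyfun) : polyFun := exist _ F PF.

Definition ev p (F : polyFun) : rat := val F p.

Lemma ev_inj (F G : polyFun) : (forall p, ev p F = ev p G) -> F = G.
Proof. by move=> FG; apply: val_inj; apply/funext. Qed.

Fact ev_is_zmod_morphism p : zmod_morphism (ev p). Proof. by []. Qed.
Fact ev_is_monoid_morphism p : monoid_morphism (ev p). Proof. by []. Qed.

HB.instance Definition _ p :=
  GRing.isZmodMorphism.Build polyFun rat (ev p) (ev_is_zmod_morphism p).
HB.instance Definition _ p :=
  GRing.isMonoidMorphism.Build polyFun rat (ev p) (ev_is_monoid_morphism p).

Fact polyFun_oner_neq0 : (1 : polyFun) != 0.
Proof.
apply/eqP => /(congr1 (ev (fun=> 0))); rewrite rmorph1 rmorph0.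
by apply/eqP; rewrite oner_eq0.
Qed.

HB.instance Definition _ :=
  GRing.PzSemiRing_isNonZero.Build polyFun polyFun_oner_neq0.

Definition polyFun_unit : pred polyFun := fun F => `[< exists G, G * F = 1 >].

Definition polyFun_inv (F : polyFun) : polyFun :=
  if pselect (exists G, G * F = 1) is left e then sval (cid e) else F.

Fact polyFun_mulVr : {in polyFun_unit, left_inverse 1 polyFun_inv *%R}.
Proof.
move=> F /asboolP e; rewrite /polyFun_inv; case: pselect => // e'.
exact: svalP (cid e').
Qed.

Fact polyFun_unitP F G : G * F = 1 -> polyFun_unit F.
Proof. by move=> e; apply/asboolP; exists G. Qed.

Fact polyFun_inv_out : {in [predC polyFun_unit], polyFun_inv =1 id}.
Proof.
by move=> F /asboolPn nu; rewrite /polyFun_inv; case: pselect => // /nu.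
Qed.

HB.instance Definition _ := GRing.ComNzRing_hasMulInverse.Build polyFun
  polyFun_mulVr polyFun_unitP polyFun_inv_out.

(** A product vanishing everywhere vanishes along the line joining a point where
    the first factor is nonzero to a point where the second one is; along this
    line both factors are nonzero polynomials in one variable. *)
Fact polyFun_integral : GRing.integral_domain_axiom polyFun.
Proof.
move=> F G FG0; apply: contraT => /norP[/eqP F0 /eqP G0].
have nz (H : polyFun) : H <> 0 -> exists p, ev p H <> 0.
  by move=> nH; apply/existsNP => H0; apply: nH; apply: ev_inj => p; rewrite H0 rmorph0.
have [p Fp] := nz F F0; have [q Gq] := nz G G0.
have [/asboolP[m Fm] /asboolP[n Gn]] := (svalP F, svalP G).
pose d : point := fun i => q i - p i.
have [[f [_ fE]] [g [_ gE]]] := (Fm p d, Gn p d).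
have : f * g = 0.
  apply: poly_inj_horner => s; rewrite hornerM horner0 -fE -gE.
  by rewrite -[LHS]/(ev (line p d s) (F * G)) FG0 rmorph0.
have l0 : line p d 0 = p by apply/funext => i; rewrite /line mul0r addr0.
have l1 : line p d 1 = q by apply/funext => i; rewrite /line mul1r addrC subrK.
move/eqP; rewrite mulf_eq0 => /orP[] /eqP z.
  by case: Fp; rewrite -l0 [LHS]fE z horner0.
by case: Gq; rewrite -l1 [LHS]gE z horner0.
Qed.

HB.instance Definition _ :=
  GRing.ComUnitRing_isIntegral.Build polyFun polyFun_integral.

(** This holds pointwise, in the ordered field of values. *)
Lemma polyFun_sqr_add_eq0 (F G : polyFun) :
  F ^+ 2 + G ^+ 2 = 0 -> F = 0 /\ G = 0.
Proof.
move=> FG0; have FG p : (ev p F == 0) && (ev p G == 0).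
  have /eqP := congr1 (ev p) FG0; rewrite rmorphD !rmorphXn rmorph0.
  by rewrite paddr_eq0 ?sqr_ge0 // !sqrf_eq0.
by split; apply: ev_inj => p; rewrite rmorph0; have /andP[/eqP ? /eqP ?] := FG p.
Qed.

(** * Scaling a set of variables *)

Definition on S p : point := fun i => if `[< S i >] then p i else 0.
Definition off S p : point := fun i => if `[< S i >] then 0 else p i.
Definition scale S (u : rat) p : point := line (off S p) (on S p) u.

Lemma scaleE S u p i : scale S u p i = if `[< S i >] then u * p i else p i.
Proof.
by rewrite /scale /line /off /on; case: asboolP => _; rewrite ?add0r ?mulr0 ?addr0.
Qed.

Lemma scale_line S u p q s :
  scale S u (line p q s) = line (scale S u p) (scale S u q) s.
Proof.
apply/funext => i; rewrite scaleE /line !scaleE.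
by case: asboolP => _; rewrite ?mulrDr // mulrCA.
Qed.

Definition evp p : {poly polyFun} -> {poly rat} := map_poly (ev p).

Lemma evp_inj (f g : {poly polyFun}) :
  (forall p u, (evp p f).[u] = (evp p g).[u]) -> f = g.
Proof.
move=> fg; apply/polyP => k; apply: ev_inj => p.
have e : evp p f = evp p g by apply: poly_inj_horner => u; apply: fg.
by have := congr1 (fun h : {poly rat} => h`_k) e; rewrite /evp !coef_map.
Qed.

(** Scaling the variables of [S] by [u] moves a point along a line, so it turns
    [F] into a polynomial in [u] at each point. Its coefficients are polynomial
    functions of the point, because by interpolation they are linear
    combinations of the functions [F \o scale S j] for [j <= n]. *)
Lemma scaling_exists S (F : polyFun) (n : nat) : polyfun_le n (val F) ->
  exists f : {poly polyFun}, (size f <= n.+1)%N /\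
    forall p u, (evp p f).[u] = ev (scale S u p) F.
Proof.
move=> Fn; have /choice[h hP] : forall p, exists h : {poly rat},
    (size h <= n.+1)%N /\ forall s, ev (scale S s p) F = h.[s].
  by move=> p; apply: Fn.
have cP k : (fun p => (h p)`_k) \in polyfun.
  have [L LP] := coef_interpolation rat n k.
  have -> : (fun p => (h p)`_k) =
      \sum_(j < n.+1) (fun p => L j * ev (scale S j%:R p) F).
    apply/funext => p; rewrite fct_sumE LP; last by have [] := hP p.
    by apply: eq_bigr => j _; have [_ ->] := hP p.
  apply: rpred_sum => j _; apply/asboolP; exists n => p q.
  have [g [gn gE]] := Fn (scale S j%:R p) (scale S j%:R q).
  exists ((L j)%:P * g); split=> [|s].
    by rewrite mul_polyC; apply: leq_trans gn; apply: size_scale_leq.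
  by rewrite scale_line hornerCM -gE.
exists (\poly_(k < n.+1) PolyFun (cP k)); split=> [|p u].
  exact: size_poly.
have [hn ->] := hP p; congr (_.[u]); apply/polyP => k.
rewrite coef_map coef_poly; case: ltnP => nk; first by [].
by rewrite raddf0 nth_default // (leq_trans hn).
Qed.

Fact scaling_subproof S (F : polyFun) : exists f : {poly polyFun},
  forall p u, (evp p f).[u] = ev (scale S u p) F.
Proof.
have /asboolP[n Fn] := svalP F.
by have [f [_ fE]] := scaling_exists S Fn; exists f.
Qed.

Definition scaling S (F : polyFun) : {poly polyFun} :=
  sval (cid (scaling_subproof S F)).

Lemma evp_scaling S F p u : (evp p (scaling S F)).[u] = ev (scale S u p) F.
Proof. exact: (svalP (cid (scaling_subproof S F))). Qed.

Fact scaling_is_zmod_morphism S : zmod_morphism (scaling S).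
Proof.
move=> F G; apply: evp_inj => p u.
by rewrite /evp rmorphB hornerD hornerN -!/(evp p _) !evp_scaling rmorphB.
Qed.

Fact scaling_is_monoid_morphism S : monoid_morphism (scaling S).
Proof.
split=> [|F G]; apply: evp_inj => p u.
  by rewrite /evp rmorph1 hornerC -!/(evp p _) evp_scaling rmorph1.
by rewrite /evp rmorphM hornerM -!/(evp p _) !evp_scaling rmorphM.
Qed.

HB.instance Definition _ S := GRing.isZmodMorphism.Build polyFun {poly polyFun}
  (scaling S) (scaling_is_zmod_morphism S).
HB.instance Definition _ S := GRing.isMonoidMorphism.Build polyFun {poly polyFun}
  (scaling S) (scaling_is_monoid_morphism S).

Lemma scaling_neq0 S F : F != 0 -> scaling S F != 0.
Proof.
apply: contraNN => /eqP F0; apply/eqP/ev_inj => p.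
have <- : scale S 1 p = p by apply/funext => i; rewrite scaleE mul1r; case: ifP.
by rewrite -evp_scaling F0 /evp rmorph0 horner0 rmorph0.
Qed.

(** The bound does not depend on [S]. It bounds the order of vanishing of [F]
    along all the sets of variables at once. *)
Lemma size_scaling F : exists n, forall S, (size (scaling S F) <= n)%N.
Proof.
have /asboolP[n Fn] := svalP F; exists n.+1 => S.
have [f [sf fE]] := scaling_exists S Fn.
by rewrite (_ : scaling S F = f) //; apply: evp_inj => p u; rewrite evp_scaling.
Qed.

Fact coordinate_polyfun (i : I) : (fun p : point => p i) \in polyfun.
Proof.
apply/asboolP; exists 1%N => p q; exists ((p i)%:P + (q i)%:P * 'X); split.
  apply: leq_trans (size_polyD _ _) _; rewrite geq_max.
  rewrite (leq_trans (size_polyC_leq1 _)) //=.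
  apply: leq_trans (size_polyMleq _ _) _; rewrite size_polyX addn2 /=.
  by rewrite ltnS size_polyC_leq1.
by move=> s; rewrite !hornerE mulrC.
Qed.

Definition coordinate (i : I) : polyFun := PolyFun (coordinate_polyfun i).

Lemma scaling_coordinate_in S i : S i ->
  scaling S (coordinate i) = (coordinate i)%:P * 'X.
Proof.
move=> Si; apply: evp_inj => p u; rewrite evp_scaling.
rewrite [LHS]scaleE asboolT // /evp rmorphM /= map_polyX map_polyC.
by rewrite !hornerE mulrC.
Qed.

Lemma scaling_coordinate_out S i : ~ S i ->
  scaling S (coordinate i) = (coordinate i)%:P.
Proof.
move=> Si; apply: evp_inj => p u; rewrite evp_scaling.
by rewrite [LHS]scaleE asboolF // /evp map_polyC hornerC.
Qed.

Lemma coordinate_neq0 i : coordinate i != 0.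
Proof.
apply/eqP => /(congr1 (ev (fun=> 1))); rewrite rmorph0.
by apply/eqP; rewrite oner_eq0.
Qed.

End PolynomialFunctions.

(** * Specialization of rational functions *)

Section Specialization.
Variables (P : idomainType).
Local Notation K := {fraction P}.
Local Notation "F %:F" := (tofrac F).
Implicit Types (phi : {rmorphism P -> {poly P}}) (x y z : K).

Lemma fraction_numden x : exists F G : P, G != 0 /\ x * G%:F = F%:F.
Proof.
elim/quotW: x => -[[F G] /= nG]; exists F, G; split=> //.
rewrite !piE; apply/eqmodP; rewrite /= /FracField.equivf /FracField.mulf.
by rewrite !numden_Ratio ?mulr1 ?oner_neq0 //= mulrC.
Qed.

(** For [phi] multiplying some variables by the indeterminate ['X], this says
    that the image of [x] under the extension of [phi] to fractions is regular
    at ['X = 0] with value [y]. The factor ['X^m] allows for a denominator [G]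
    that is divisible by ['X] after scaling. *)
Definition specializes phi (x y : K) : Prop :=
  exists (F G : P) (m : nat) (f g : {poly P}),
    [/\ x * G%:F = F%:F,
        phi F = f * 'X^m, phi G = g * 'X^m,
        g`_0 != 0 & y * (g`_0)%:F = (f`_0)%:F].

Lemma specializesD phi x y x' y' :
  specializes phi x y -> specializes phi x' y' -> specializes phi (x + x') (y + y').
Proof.
move=> [F [G [m [f [g [xE FE GE g0 yE]]]]]].
move=> [F' [G' [m' [f' [g' [xE' FE' GE' g0' yE']]]]]].
exists (F * G' + F' * G), (G * G'), (m + m')%N, (f * g' + f' * g), (g * g').
split.
- rewrite !(rmorphM, rmorphD) /= -xE -xE' mulrDl mulrA; congr (_ + _).
  by rewrite [_ * G'%:F]mulrC mulrA.
- rewrite rmorphD !rmorphM /= FE FE' GE GE' exprD [RHS]mulrDl; congr (_ + _).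
    by rewrite mulrACA.
  by rewrite mulrACA [X in _ * X = _]mulrC.
- by rewrite rmorphM /= GE GE' exprD mulrACA.
- by rewrite coef0M mulf_neq0.
- rewrite coefD !coef0M !(rmorphM, rmorphD) /= -yE -yE' mulrDl mulrA.
  by congr (_ + _); rewrite mulrAC -mulrA.
Qed.

Lemma specializesM phi x y x' y' :
  specializes phi x y -> specializes phi x' y' -> specializes phi (x * x') (y * y').
Proof.
move=> [F [G [m [f [g [xE FE GE g0 yE]]]]]].
move=> [F' [G' [m' [f' [g' [xE' FE' GE' g0' yE']]]]]].
exists (F * F'), (G * G'), (m + m')%N, (f * f'), (g * g').
split.
- by rewrite !rmorphM /= -xE -xE' mulrACA.
- by rewrite !rmorphM /= FE FE' exprD mulrACA.
- by rewrite rmorphM /= GE GE' exprD mulrACA.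
- by rewrite coef0M mulf_neq0.
- by rewrite !coef0M !rmorphM /= -yE -yE' mulrACA.
Qed.

Lemma specializesN phi x y : specializes phi x y -> specializes phi (- x) (- y).
Proof.
move=> [F [G [m [f [g [xE FE GE g0 yE]]]]]]; exists (- F), G, m, (- f), g.
by split; rewrite // ?rmorphN ?coefN ?rmorphN ?mulNr /= ?xE ?FE ?yE ?mulNr.
Qed.

Lemma specializes1 phi : specializes phi 1 1.
Proof.
exists 1, 1, 0%N, 1, 1.
split; rewrite ?rmorph1 ?expr0 ?mulr1 ?coef1 ?oner_neq0 //.
by rewrite rmorph1 mulr1.
Qed.

Lemma specializes_neq0 phi x y : specializes phi x y -> y != 0 -> x != 0.
Proof.
move=> [F [G [m [f [g [xE FE GE g0 yE]]]]]]; apply: contra_neq => x0.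
move: xE; rewrite x0 mul0r => /esym/eqP; rewrite tofrac_eq0 => /eqP F0.
move: FE; rewrite F0 rmorph0 => /esym/eqP.
rewrite mulf_eq0 expf_eq0 polyX_eq0 andbF orbF => /eqP f0.
move/eqP: yE; rewrite f0 coef0 rmorph0 mulf_eq0 tofrac_eq0 (negPf g0) orbF.
by move/eqP.
Qed.

Lemma specializesV phi x y : specializes phi x y -> y != 0 ->
  specializes phi x^-1 y^-1.
Proof.
move=> xy y0; have x0 := specializes_neq0 xy y0.
move: xy => [F [G [m [f [g [xE FE GE g0 yE]]]]]].
exists G, F, m, g, f; split=> //.
- by rewrite -xE mulKf.
- apply: contra_neq y0 => f0; move/eqP: yE.
  by rewrite f0 rmorph0 mulf_eq0 tofrac_eq0 (negPf g0) orbF => /eqP.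
- by apply: (mulfI y0); rewrite (mulVKf y0); exact: esym yE.
Qed.

Lemma specializes_scaled phi (c : P) : phi c = c%:P * 'X ->
  specializes phi c%:F 0.
Proof.
move=> cE; exists c, 1, 0%N, (c%:P * 'X), 1; split.
- by rewrite rmorph1 mulr1.
- by rewrite expr0 mulr1.
- by rewrite rmorph1 mul1r.
- by rewrite coef1 oner_neq0.
- by rewrite coefMX rmorph0 mul0r.
Qed.

Lemma specializes_fixed phi (c : P) : phi c = c%:P ->
  specializes phi c%:F c%:F.
Proof.
move=> cE; exists c, 1, 0%N, c%:P, 1; split.
- by rewrite rmorph1 mulr1.
- by rewrite expr0 mulr1.
- by rewrite rmorph1 mul1r.
- by rewrite coef1 oner_neq0.
- by rewrite coef1 rmorph1 mulr1 coefC.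
Qed.

Lemma poly_order (R : idomainType) (f : {poly R}) : f != 0 ->
  exists m g, [/\ f = g * 'X^m, g`_0 != 0 & (m < size f)%N].
Proof.
move=> f0; have [m [g]] := multiplicity_XsubC f 0.
rewrite f0 /= subr0 /root horner_coef0 => g0 fE; exists m, g; split=> //.
rewrite fE size_mulXn; last by apply: contra_neq g0 => ->; rewrite coef0.
rewrite -[X in (X < _)%N]add0n addnC ltn_add2l size_poly_gt0.
by apply: contra_neq g0 => ->; rewrite coef0.
Qed.

(** Write [z] as a quotient with numerator [B]. The image of [z] under [phi] has
    order at most the degree of [phi B], whereas that of [x ^+ n] has order at
    least [n] when [x] specializes to [0]. *)
Lemma specializes_div z : z != 0 -> exists2 B : P, B != 0 &
  forall phi x n, phi B != 0 -> (size (phi B) <= n)%N ->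
    specializes phi x 0 -> specializes phi (x ^+ n / z) 0.
Proof.
move=> z0; have [B [C [C0 zE]]] := fraction_numden z; exists B.
  apply: contra_neq z0 => B0; move/eqP: zE.
  by rewrite B0 rmorph0 mulf_eq0 tofrac_eq0 (negPf C0) orbF => /eqP.
move=> phi x n phiB0 phiBn [F [G [m [f [g [xE FE GE g0 yE]]]]]].
have [q [h [BE h0 qB]]] := poly_order phiB0.
have qn : (q < n)%N by apply: leq_trans phiBn.
have f0 : f`_0 = 0 by move/esym/eqP: yE; rewrite mul0r tofrac_eq0 => /eqP.
have [f1 fE] : exists f1, f = f1 * 'X.
  have /factor_theorem[f1 ->] : root f 0 by rewrite /root horner_coef0 f0.
  by exists f1; rewrite subr0.
exists (F ^+ n * C), (G ^+ n * B), (m * n + q)%N.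
exists (f1 ^+ n * phi C * 'X^(n - q)), (g ^+ n * h); split.
- rewrite !rmorphM !rmorphXn /= -xE -zE exprMn mulrACA.
  by rewrite mulKf.
- rewrite rmorphM rmorphXn /= FE fE !exprMn -exprM exprD.
  have -> : 'X^n = 'X^(n - q) * 'X^q :> {poly P} by rewrite -exprD subnK // ltnW.
  rewrite -!mulrA; congr (_ * _); rewrite [RHS]mulrC -!mulrA.
  by congr (_ * _); rewrite mulrCA.
- by rewrite rmorphM rmorphXn /= GE BE !exprMn -exprM exprD mulrACA.
- rewrite coef0M mulf_neq0 //.
  by rewrite -horner_coef0 horner_exp expf_neq0 // horner_coef0.
- by rewrite mul0r coefMXn subn_gt0 qn rmorph0.
Qed.

(** Clear denominators. *)
Lemma fraction_sqr_add_eq0 x y :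
  (forall F G : P, F ^+ 2 + G ^+ 2 = 0 -> F = 0) -> x ^+ 2 + y ^+ 2 = 0 -> x = 0.
Proof.
move=> realP; have [F [G [G0 xE]]] := fraction_numden x.
have [F' [G' [G0' yE]]] := fraction_numden y.
move=> xy0; have : F * G' = 0.
  apply: (realP _ (F' * G)); apply/eqP; rewrite -tofrac_eq0; apply/eqP.
  rewrite rmorphD !rmorphXn !rmorphM /= -xE -yE.
  rewrite -[x * _ * _]mulrA -[y * _ * _]mulrA [G'%:F * _]mulrC.
  by rewrite (exprMn 2 x) (exprMn 2 y) -mulrDl xy0 mul0r.
move=> /eqP; rewrite mulf_eq0 (negPf G0') orbF => /eqP F0.
by move/eqP: xE; rewrite F0 rmorph0 mulf_eq0 tofrac_eq0 (negPf G0) orbF => /eqP.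
Qed.
End Specialization.

(** The properties of a field of rational functions in variables indexed by [I],
    with the places that set to [0] all the variables in a set [S]. In
    [sf_spec_div] the exponent [N] is the same for all [S]. *)
Record specialization_field (I : Type) := SpecializationField {
  sf_field :> fieldType ;
  sf_var : I -> sf_field ;
  sf_spec : set I -> sf_field -> sf_field -> Prop ;
  sf_spec1 : forall S, sf_spec S 1 1 ;
  sf_specN : forall S x y, sf_spec S x y -> sf_spec S (- x) (- y) ;
  sf_specD : forall S x y x' y', sf_spec S x y -> sf_spec S x' y' ->
    sf_spec S (x + x') (y + y') ;
  sf_specM : forall S x y x' y', sf_spec S x y -> sf_spec S x' y' ->
    sf_spec S (x * x') (y * y') ;
  sf_spec_neq0 : forall S x y, sf_spec S x y -> y != 0 -> x != 0 ;
  sf_specV : forall S x y, sf_spec S x y -> y != 0 -> sf_spec S x^-1 y^-1 ;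
  sf_spec_div : forall z, z != 0 -> exists N, forall n, (N <= n)%N ->
    forall S x, sf_spec S x 0 -> sf_spec S (x ^+ n / z) 0 ;
  sf_var_neq0 : forall i, sf_var i != 0 ;
  sf_spec_var_in : forall S i, S i -> sf_spec S (sf_var i) 0 ;
  sf_spec_var_out : forall S i, ~ S i -> sf_spec S (sf_var i) (sf_var i) ;
  sf_real : forall x y : sf_field, x ^+ 2 + y ^+ 2 = 0 -> x = 0
}.

Lemma specialization_field_exists (I : Type) :
  inhabited (specialization_field I).
Proof.
unshelve refine (inhabits (@SpecializationField I {fraction polyFun I}
  (fun i => tofrac (coordinate i)) (fun S => specializes (scaling S))
  _ _ _ _ _ _ _ _ _ _ _)).
- by move=> S; apply: specializes1.
- by move=> S; apply: specializesN.
- by move=> S; apply: specializesD.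
- by move=> S; apply: specializesM.
- by move=> S; apply: specializes_neq0.
- by move=> S; apply: specializesV.
- move=> z /specializes_div[B B0 BP]; have [N NB] := size_scaling B.
  exists N => n Nn S x; apply: BP; first exact: scaling_neq0.
  exact: leq_trans (NB S) Nn.
- by move=> i; rewrite tofrac_eq0 coordinate_neq0.
- by move=> S i Si; apply: specializes_scaled; apply: scaling_coordinate_in.
- by move=> S i Si; apply: specializes_fixed; apply: scaling_coordinate_out.
- move=> x y; apply: fraction_sqr_add_eq0 => F G /polyFun_sqr_add_eq0[] //.
Qed.

(** * The ring of compatible sections *)

Section SpecializationFieldTheory.
Variables (I : Type) (K : specialization_field I) (S : set I).

Lemma sf_spec0 : sf_spec S (0 : K) 0.
Proof.
have s1 := @sf_spec1 _ K S; have := sf_specD s1 (sf_specN s1).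
by rewrite subrr.
Qed.

Lemma sf_specX (x y : K) n : sf_spec S x y -> sf_spec S (x ^+ n) (y ^+ n).
Proof.
move=> xy; elim: n => [|n IHn]; first exact: sf_spec1.
by rewrite !exprS; apply: sf_specM.
Qed.
End SpecializationFieldTheory.

Lemma zero_locus_openC (R : comPzRingType) (E : set R) : open (~` zero_locus E).
Proof. by exists E. Qed.

Section SpectralSpace.
Variables (X : topologicalType) (G : set (set X)).
Hypotheses (basisG : basis (finI_from G id)) (ucG : ultracomplete G).
Hypothesis sepG : forall x y, (forall U, G U -> (U x <-> U y)) -> x = y.
Variable K : specialization_field (set X).

(** The specialization order of [X]: the point [y] is in the closure of [x]. *)
Definition generizes (x y : X) : Prop := forall U, G U -> U y -> U x.

Definition separating (x y : X) : set (set X) := [set U | [/\ G U, U x & ~ U y]].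

(** Sections are locally constant for the patch topology and compatible with
    specialization. A variable [U] must tend to [0] on the way from [x] to [y]
    exactly when [U] contains [x] but not [y]. *)
Definition section_pred : {pred X -> K} := fun a => `[<
  (forall x, exists C, [/\ constructible G C, C x & forall y, C y -> a y = a x]) /\
  (forall x y, generizes x y -> sf_spec (separating x y) (a x) (a y)) >].

Lemma section_subring : subring_closed section_pred.
Proof.
split=> [|a b /asboolP[ca sa] /asboolP[cb sb]|a b /asboolP[ca sa] /asboolP[cb sb]].
- apply/asboolP; split=> [x|x y _]; last exact: sf_spec1.
  by exists setT; split=> //; apply: constructibleT.
- apply/asboolP; split=> [x|x y xy].
    have [[C [cC Cx aC]] [D [cD Dx bD]]] := (ca x, cb x).
    exists (C `&` D); split=> // [|y [Cy Dy]]; first exact: constructibleI.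
    by rewrite !fctE aC // bD.
  by apply: sf_specD; [apply: sa|apply/sf_specN/sb].
- apply/asboolP; split=> [x|x y xy].
    have [[C [cC Cx aC]] [D [cD Dx bD]]] := (ca x, cb x).
    exists (C `&` D); split=> // [|y [Cy Dy]]; first exact: constructibleI.
    by rewrite !fctE aC // bD.
  by apply: sf_specM; [apply: sa|apply: sb].
Qed.

HB.instance Definition _ :=
  GRing.isSubringClosed.Build (X -> K) section_pred section_subring.

Definition sectionRing : Type := {a : X -> K | a \in section_pred}.
HB.instance Definition _ :=
  SubType.copy sectionRing {a : X -> K | a \in section_pred}.
HB.instance Definition _ := [Choice of sectionRing by <:].
HB.instance Definition _ :=
  GRing.SubChoice_isSubComPzRing.Build _ _ sectionRing section_subring.

Definition section_of (a : X -> K) (aP : a \in section_pred) : sectionRing :=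
  exist _ a aP.

Implicit Types a b c : sectionRing.

Definition value (x : X) a : K := val a x.

Fact value_is_zmod_morphism x : zmod_morphism (value x). Proof. by []. Qed.
Fact value_is_monoid_morphism x : monoid_morphism (value x). Proof. by []. Qed.

HB.instance Definition _ x := GRing.isZmodMorphism.Build sectionRing K
  (value x) (value_is_zmod_morphism x).
HB.instance Definition _ x := GRing.isMonoidMorphism.Build sectionRing K
  (value x) (value_is_monoid_morphism x).

Lemma value_inj a b : (forall x, value x a = value x b) -> a = b.
Proof. by move=> ab; apply: val_inj; apply/funext. Qed.

Lemma value_spec a x y : generizes x y ->
  sf_spec (separating x y) (value x a) (value y a).
Proof. by have /asboolP[_] := svalP a; apply. Qed.

Lemma value_const a x : exists C,
  [/\ constructible G C, C x & forall y, C y -> value y a = value x a].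
Proof. by have /asboolP[+ _] := svalP a; apply. Qed.

(** Local constancy turns a limit of an ultrafilter into an almost sure equality
    of values. *)
Lemma value_ultralimit (F : set_system X) a x : UltraFilter F ->
  ultralimit (constructible G) F x -> F [set y | value y a = value x a].
Proof.
move=> UF Fx; have [C [cC Cx aC]] := value_const a x.
by apply: (filterS aC); apply/(Fx C cC).
Qed.

(** If every basic neighbourhood of [x] met the zeros of [a], some limit [y] of
    zeros would be a generization of [x]. Then [a] vanishes at [y], by local
    constancy, so it vanishes at its specialization [x]. *)
Lemma open_nonzero a : open [set x | value x a <> 0].
Proof.
rewrite openE => x ax.
pose B := [set D : set X | exists V, [/\ finI_from G id V, V x &
  V `&` [set y | value y a = 0] `<=` D]].
have [[V [GV Vx Va]]|B0] := pselect (B set0).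
  apply: (@filterS _ _ _ V); first by move=> y Vy ay; apply: (Va y).
  by apply: open_nbhs_nbhs; split=> //; apply: basisG.1.
have BT : B setT.
  by exists setT; split=> //; apply: finI_fromT.
have BI : setI_closed B.
  move=> D D' [V [GV Vx VD]] [V' [GV' Vx' VD']]; exists (V `&` V').
  split=> //; first exact: finI_fromI.
  by move=> y [[Vy V'y] ay]; split; [apply: VD|apply: VD'].
have [F [y [UF Fy BF]]] := ultracomplete_filter ucG BT BI B0.
have yx : generizes y x.
  move=> U GU Ux; apply/(Fy U (sub_constructible GU)).
  apply: BF; exists U; split=> //; exact: finI_from1.
have Fa0 : F [set z | value z a = 0].
  by apply: BF; exists setT; rewrite setTI; split=> //; apply: finI_fromT.
have [z [/= az0 az]] := filter_ex (filterI Fa0 (value_ultralimit a UF Fy)).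
have /eqP[] : value y a != 0 by apply: sf_spec_neq0 (value_spec a yx) _; apply/eqP.
by rewrite -az.
Qed.

(** Each value of [b] has its own bound, valid on a patch neighbourhood, and
    compactness of the patch topology makes the bound uniform. *)
Lemma value_div_bound b : exists N, forall x, value x b != 0 ->
  forall n, (N <= n)%N -> forall S (z : K), sf_spec S z 0 ->
    sf_spec S (z ^+ n / value x b) 0.
Proof.
pose good N (w : K) := w != 0 -> forall n, (N <= n)%N ->
  forall S (z : K), sf_spec S z 0 -> sf_spec S (z ^+ n / w) 0.
suff [N NP] : exists N, forall x, good N (value x b) by exists N => x; apply: NP.
apply: contrapT => nogood.
pose B := [set D : set X | exists N, [set x | ~ good N (value x b)] `<=` D].
have [F [x [UF Fx BF]]] : exists F x,
    [/\ UltraFilter F, ultralimit (constructible G) F x & B `<=` F].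
  apply: ultracomplete_filter => //.
  - by exists 0%N.
  - move=> D D' [N ND] [N' ND']; exists (maxn N N') => x /= bad.
    split; [apply: ND|apply: ND'] => /= ok; apply: bad => nz n.
      by rewrite geq_max => /andP[+ _]; apply: ok.
    by rewrite geq_max => /andP[_]; apply: ok.
  - move=> [N N0]; apply: nogood; exists N => x.
    by apply: contrapT => bad; apply: (N0 x).
have [N NP] : exists N, good N (value x b).
  have [->|nz] := eqVneq (value x b) 0; first by exists 0%N; rewrite /good eqxx.
  by have [N NP] := sf_spec_div nz; exists N => _; apply: NP.
have FN : F [set y | ~ good N (value y b)] by apply: BF; exists N.
have [y [/= ybad yE]] := filter_ex (filterI FN (value_ultralimit b UF Fx)).
by apply: ybad; rewrite yE.
Qed.

(** The quotient [a ^+ n / b] on the nonvanishing set of [b] is extended by [0].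
    The only delicate specializations are those from a point where [b] is
    nonzero to a point where [b] vanishes: there [a] specializes to [0], and
    [n] is chosen so large that the quotient still does. *)
Lemma section_dvd a b : (forall x, value x b = 0 -> value x a = 0) ->
  exists n c, a ^+ n = c * b.
Proof.
move=> ba; have [N NP] := value_div_bound b.
(* Division by zero gives zero, which is the extension wanted. *)
pose f (x : X) : K := value x a ^+ N.+1 / value x b.
have fP : f \in section_pred.
  apply/asboolP; split=> [x|x y xy].
    have [[C [cC Cx aC]] [D [cD Dx bD]]] := (value_const a x, value_const b x).
    exists (C `&` D); split=> // [|y [Cy Dy]]; first exact: constructibleI.
    by rewrite /f aC // bD.
  have [ax bx] := (value_spec a xy, value_spec b xy); rewrite /f.
  have [by0|by0] := eqVneq (value y b) 0; last first.
    by apply: sf_specM; [apply: sf_specX|apply: sf_specV].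
  rewrite by0 invr0 mulr0; have [bx0|bx0] := eqVneq (value x b) 0.
    by rewrite bx0 invr0 mulr0; apply: sf_spec0.
  by apply: NP => //; rewrite -(ba y by0).
(* The exponent is positive, so that both sides vanish where [b] does. *)
exists N.+1, (section_of fP); apply: value_inj => x.
rewrite rmorphXn rmorphM /= [X in X * _](_ : _ = f x) // /f.
have [bx0|bx0] := eqVneq (value x b) 0; last by rewrite divfK.
by rewrite (ba x bx0) bx0 mulr0 exprS mul0r.
Qed.

Definition vanishing (x : X) : set sectionRing := [set a | value x a = 0].

Lemma vanishing_prime x : prime_ideal (vanishing x).
Proof.
split; rewrite /vanishing /=.
- exact: rmorph0.
- by move=> a b a0 b0; rewrite rmorphD /= a0 b0 addr0.
- by move=> a b b0; rewrite rmorphM /= b0 mulr0.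
- by rewrite rmorph1; apply/eqP; rewrite oner_eq0.
- by move=> a b /eqP; rewrite rmorphM /= mulf_eq0 => /orP[] /eqP; [left|right].
Qed.

Lemma prime_ideal_exp (R : comPzRingType) (P : set R) (z : R) n :
  prime_ideal P -> P (z ^+ n) -> P z.
Proof.
move=> [_ _ _ P1 PM]; elim: n => [//|n IHn].
by rewrite exprS => /PM[].
Qed.

(** The zero sets of the members of [P] and the nonvanishing sets of the other
    sections have the finite intersection property. Finitely many of the latter
    are handled by a product and finitely many of the former by a sum of
    squares; if they did not meet, [section_dvd] would put a power of an element
    outside [P] in [P]. A point common to all of them defines [P]. *)
Lemma prime_vanishing (P : set sectionRing) : prime_ideal P ->
  exists x, P = vanishing x.
Proof.
move=> primeP; have [P0 PD PM P1 Ppr] := primeP.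
pose B := [set D : set X | exists a b, [/\ ~ P a, P b &
  [set x | value x a <> 0 /\ value x b = 0] `<=` D]].
have [F [x [UF Fx BF]]] : exists F x,
    [/\ UltraFilter F, ultralimit (constructible G) F x & B `<=` F].
  apply: ultracomplete_filter => //.
  - by exists 1, 0.
  - move=> D D' [a [b [Pa Pb abD]]] [a' [b' [Pa' Pb' abD']]].
    exists (a * a'), (b ^+ 2 + b' ^+ 2); split.
    + by move=> /Ppr[].
    + by apply: PD; rewrite expr2; apply: PM.
    + move=> x /= []; rewrite rmorphM rmorphD !rmorphXn /= => /eqP.
      rewrite mulf_eq0 => /norP[/eqP ax /eqP ax'] bx.
      split; [apply: abD|apply: abD']; split=> //; first exact: sf_real bx.
      by move: bx; rewrite addrC => /sf_real.
  - move=> [a [b [Pa Pb ab0]]]; apply: Pa.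
    have [n [c acb]] : exists n c, a ^+ n = c * b.
      apply: section_dvd => x bx; apply: contrapT => ax; exact: (ab0 x).
    by apply: (@prime_ideal_exp _ _ _ n) => //; rewrite acb; apply: PM.
exists x; apply/seteqP; split=> a /=; rewrite /vanishing /=.
  move=> Pa; have Fa : F [set y | value y a = 0].
    by apply: BF; exists 1, a; split=> // y [].
  have [y [/= ay ayx]] := filter_ex (filterI Fa (value_ultralimit a UF Fx)).
  by rewrite -ayx.
move=> ax; apply: contrapT => nPa; have Fa : F [set y | value y a <> 0].
  by apply: BF; exists a, 0; split=> // y [].
have [y [/= ay ayx]] := filter_ex (filterI Fa (value_ultralimit a UF Fx)).
by apply: ay; rewrite ayx.
Qed.

Fact indicator_section (U : set X) : G U ->
  (fun x => if `[< U x >] then sf_var K U else 0) \in section_pred.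
Proof.
move=> GU; apply/asboolP; split=> [x|x y xy].
  have cU := sub_constructible GU; have [Ux|Ux] := pselect (U x).
    by exists U; split=> // y Uy; rewrite !asboolT.
  exists (~` U); split=> //; first exact: constructibleC.
  by move=> y Uy; rewrite !asboolF.
have [Uy|Uy] := pselect (U y).
  rewrite !asboolT //; last exact: xy.
  by apply: sf_spec_var_out => -[].
rewrite (asboolF Uy); have [Ux|Ux] := pselect (U x).
  by rewrite asboolT //; apply: sf_spec_var_in.
by rewrite asboolF //; apply: sf_spec0.
Qed.

Lemma section_indicator (U : set X) : G U ->
  exists a, forall x, value x a = 0 <-> ~ U x.
Proof.
move=> GU; exists (section_of (indicator_section GU)) => x; rewrite /value /=.
case: asboolP => // Ux; split=> // /eqP.
by rewrite (negPf (sf_var_neq0 _ _)).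
Qed.

(** The bijection identifies the nonvanishing set of a section with a basic open
    set of the spectrum, and the members of [G] are such sets. *)
Lemma homeomorphic_Spec_section : homeomorphic X (Spec sectionRing).
Proof.
pose f x : Spec sectionRing := exist _ _ (vanishing_prime x).
have fsurj (P : Spec sectionRing) : exists x, sval P = vanishing x.
  exact: prime_vanishing (svalP P).
have [g gP] := choice fsurj.
have gE P a : sval P a <-> value (g P) a = 0 by rewrite gP.
have vinj x y : vanishing x = vanishing y -> x = y.
  move=> xy; apply: sepG => U GU; have [a aU] := section_indicator GU.
  have [h1 h2] : vanishing x a <-> vanishing y a by rewrite xy.
  have [h3 h4] := aU x; have [h5 h6] := aU y.
  split=> Uz; apply: contrapT => nU.
    by apply: (h3 _ Uz); apply: h2; apply: h6.
  by apply: (h5 _ Uz); apply: h1; apply: h4.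
exists f, g; split.
- by move=> x; apply: vinj; rewrite -gP.
- move=> P; apply: eq_sig_hprop; [move=> *; exact: Prop_irrelevance|exact/esym/gP].
- apply/continuousP => _ [E ->]; rewrite (_ : _ @^-1` _ =
      \bigcup_(a in E) [set x | value x a <> 0]).
    by apply: bigcup_open => a _; apply: open_nonzero.
  apply/seteqP; split=> x /=.
    by move=> /existsNP[a /not_implyP[Ea xa]]; exists a.
  by move=> [a Ea xa] Ex; apply: xa; apply: Ex.
- apply/continuousP => W oW; rewrite openE => P /= WgP.
  have [V [GV Vx] VW] := basisG.2 (g P) W (open_nbhs_nbhs (conj oW WgP)).
  apply: (@filterS _ _ _ (g @^-1` V)); first by move=> Q /VW.
  apply: open_nbhs_nbhs; split=> //.
  move: V GV {Vx VW}; apply: finI_from_ind.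
  + exact: openT.
  + by move=> V V'; apply: openI.
  + move=> U GU; have [a aU] := section_indicator GU.
    rewrite (_ : _ @^-1` _ = ~` zero_locus [set a]).
      exact: zero_locus_openC.
    apply/seteqP; split=> Q /=.
      by move=> UQ /(_ a erefl) /gE /aU.
    by move=> nQ; apply: contrapT => /aU /gE Qa; apply: nQ => _ ->.
Qed.
End SpectralSpace.

(** Hochster's theorem, for a space given by a subbasis. *)
Theorem spectral_space_subbasis (X : topologicalType) (G : set (set X)) :
  basis (finI_from G id) -> ultracomplete G ->
  (forall x y, (forall U, G U -> (U x <-> U y)) -> x = y) -> spectral_space X.
Proof.
move=> bG ucG sepG; have [K] := specialization_field_exists (set X).
exists (sectionRing G K); exact: homeomorphic_Spec_section.
Qed.

Section SpvTopology.
Variable A : comMonoid0Type.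

Lemma Spv_basis : basis (finI_from (@Spv_subbasis A) id).
Proof. exact: subbase_basis. Qed.

Lemma Spv_ultracomplete : ultracomplete (@Spv_subbasis A).
Proof.
move=> F UF; have [p pF] := Spv_ultralimit UF; exists p => _ [a [b ->]].
exact: pF.
Qed.
End SpvTopology.

Theorem theorem5p18 (A : comMonoid0Type) :
  [/\ spectral_space (Spv A),
      finI_from (@Spv_subbasis A) id `<=` @qc_open (Spv A),
      basis (finI_from (@Spv_subbasis A) id)
    & @basis (patch (Spv A)) (smallest (@boolean_subalgebra _) (@Spv_subbasis A))]
  /\
  [/\ forall (B : comMonoid0Type) (f : {monoid0 A -> B}),
        (forall v : valuation B, Spv_map f (Spv_pi v) = Spv_pi (val_comp v f))
        /\ spectral_map (Spv_map f),
      Spv_map (idfun : {monoid0 A -> A}) = idfun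
    & forall (B C : comMonoid0Type) (f : {monoid0 A -> B}) (g : {monoid0 B -> C}),
        Spv_map (g \o f : {monoid0 A -> C}) = Spv_map f \o Spv_map g].
Proof.
have mapE (M N : comMonoid0Type) (f : {monoid0 M -> N}) (p : Spv N) (a b : M) :
    spv_le (Spv_map f p) a b <-> spv_le p (f a) (f b).
  exact: spv_le_pi.
pose bA := Spv_basis; pose ucA := Spv_ultracomplete.
split; split=> //.
- apply: spectral_space_subbasis (bA A) (ucA A) _ => p q pq.
  by apply: Spv_basic_separated => a b; apply: pq; exists a, b.
- exact: qc_open_finI (bA A) (ucA A).
- exact: basis_patch_constructible (bA A) (ucA A).
- move=> B f; split=> [v|].
    by apply: spv_le_inj => a b; rewrite mapE !spv_le_pi.
  apply: spectral_map_subbasis (bA B) (ucA B) (bA A) _ => _ [a [b ->]].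
  exists (f a), (f b); rewrite !Spv_basicE; apply/seteqP.
  by split=> p /= []; rewrite !mapE monoid0_morph0.
- by apply/funext => p; apply: spv_le_inj => a b; rewrite mapE.
- by move=> B C f g; apply/funext => p; apply: spv_le_inj => a b; rewrite !mapE.
Qed.
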